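(* For $d\ge3$ there exist a (smooth, strictly) convex Hamiltonian $H=H(p)$ on $\mathbb R^d$ and a piecewise linear viscosity solution $\phi$ of the Hamilton--Jacobi equation $\partial\phi/\partial t+H(\nabla\phi)=0$ such that at a certain singular point $(t,x)$ of $\phi$ there are three distinct self-consistent values of velocity.
   Context: Let $\phi$ be a viscosity solution of $\partial\phi/\partial t+H(\nabla\phi)=0$ with $x\in\mathbb R^d$ which near a point $(t,x)$ is the pointwise minimum of finitely many smooth solutions $\phi_i$, $i\in\mathcal I$ (linear functions of $(t,x)$ in the piecewise linear case), all having the same value at $(t,x)$. The point $(t,x)$ is singular if $\phi$ is not differentiable there. Put $p_i=\nabla\phi_i(t,x)$, $H_i=H(p_i)$, and $v_i=\nabla_pH(p_i)$ (the Legendre transform of $p_i$). For $v\in\mathbb R^d$ let $$I(v)=\{j\in\mathcal I:\ -H_j+p_j\cdot v=\min_{i\in\mathcal I}(-H_i+p_i\cdot v)\}.$$ A velocity $v^\dagger\in\mathbb R^d$ is called self-consistent at $(t,x)$ if $$v^\dagger=\sum_{j\in I(v^\dagger)}\pi_jv_j\quad\text{for some }\pi_j\ge0,\ \sum_{j\in I(v^\dagger)}\pi_j=1,$$ i.e. $v^\dagger$ belongs to the convex hull of $\{v_j:j\in I(v^\dagger)\}$. *)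

(* Defs.v *)
From mathcomp Require Import all_boot all_order all_algebra.
From mathcomp Require Import all_classical all_reals all_analysis.

Set Implicit Arguments.
Unset Strict Implicit.
Unset Printing Implicit Defensive.

Import Order.TTheory GRing.Theory Num.Theory.
Import numFieldNormedType.Exports.
Local Open Scope classical_set_scope.
Local Open Scope ring_scope.

Definition dotv (R : realType) (d : nat) (u v : 'rV[R]_d) : R :=
  \sum_(i < d) u ord0 i * v ord0 i.

(* Points of space-time are written z = (t, x). *)
Definition spacetime (R : realType) (d : nat) : normedModType R :=
  (R^o * 'rV[R]_d)%type.

Definition gradient (R : realType) (d : nat) (f : 'rV[R]_d -> R^o)
    (x : 'rV[R]_d) : 'rV[R]_d :=
  \row_(i < d) 'D_(delta_mx ord0 i) f x.

Definition dt (R : realType) (d : nat) (f : spacetime R d -> R^o)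
    (z : spacetime R d) : R :=
  derive1 (fun s : R => f (s, z.2)) z.1.

Definition dx (R : realType) (d : nat) (f : spacetime R d -> R^o)
    (z : spacetime R d) : 'rV[R]_d :=
  gradient (fun y => f (z.1, y)) z.2.

(* Functions of class C^k; in finite dimension, continuity of all directional
   derivatives v |-> 'D_v f is continuity of the differential. *)
Fixpoint Ck (R : realType) (V : normedModType R) (k : nat) (f : V -> R^o)
    : Prop :=
  if k is k'.+1 then
    (forall x, differentiable f x) /\ (forall v, Ck k' ('D_v f))
  else continuous f.

Definition smooth (R : realType) (V : normedModType R) (f : V -> R^o) : Prop :=
  forall k, Ck k f.

Definition strictly_convex (R : realType) (d : nat) (H : 'rV[R]_d -> R^o)
    : Prop :=
  forall (p q : 'rV[R]_d) (s : R), p <> q -> 0 < s -> s < 1 ->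
    H (s *: p + (1 - s) *: q) < s * H p + (1 - s) * H q.

Definition classical_solution (R : realType) (d : nat) (H : 'rV[R]_d -> R^o)
    (f : spacetime R d -> R^o) : Prop :=
  smooth f /\ forall z, dt f z + H (dx f z) = 0.

(* Viscosity solutions of f_t + H(grad f) = 0 on all of R x R^d, in the sense
   of Crandall and Lions: continuous, and tested from above and from below by
   functions of class C^1. *)
Definition viscosity_subsolution (R : realType) (d : nat)
    (H : 'rV[R]_d -> R^o) (f : spacetime R d -> R^o) : Prop :=
  forall (psi : spacetime R d -> R^o) (z : spacetime R d), Ck 1 psi ->
    (\forall w \near z, f w - psi w <= f z - psi z) ->
    dt psi z + H (dx psi z) <= 0.

Definition viscosity_supersolution (R : realType) (d : nat)
    (H : 'rV[R]_d -> R^o) (f : spacetime R d -> R^o) : Prop :=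
  forall (psi : spacetime R d -> R^o) (z : spacetime R d), Ck 1 psi ->
    (\forall w \near z, f z - psi z <= f w - psi w) ->
    0 <= dt psi z + H (dx psi z).

Definition viscosity_solution (R : realType) (d : nat)
    (H : 'rV[R]_d -> R^o) (f : spacetime R d -> R^o) : Prop :=
  [/\ continuous f, viscosity_subsolution H f & viscosity_supersolution H f].

(* "Linear" functions of (t, x) may have a constant term. *)
Definition affine_fun (R : realType) (d : nat) (l : spacetime R d -> R^o)
    : Prop :=
  exists (a b : R) (p : 'rV[R]_d), forall z, l z = a + b * z.1 + dotv p z.2.

Definition polyhedron (R : realType) (d : nat) (P : set (spacetime R d))
    : Prop :=
  exists (m : nat) (l : 'I_m -> spacetime R d -> R^o),
    (forall i, affine_fun (l i)) /\ P = [set z | forall i, 0 <= l i z].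

Definition piecewise_linear (R : realType) (d : nat)
    (f : spacetime R d -> R^o) : Prop :=
  exists (m : nat) (P : 'I_m -> set (spacetime R d)),
    [/\ forall i, polyhedron (P i),
        forall z, exists i, P i z &
        forall i, exists2 l, affine_fun l & forall z, P i z -> f z = l z].

Definition singular (R : realType) (d : nat) (f : spacetime R d -> R^o)
    (z : spacetime R d) : Prop :=
  ~ differentiable f z.

Definition is_min (R : realType) (I : finType) (g : I -> R) (m : R) : Prop :=
  (forall i, m <= g i) /\ (exists i, m = g i).

(* Near z, f is the minimum of the linear solutions f_ i, all of which take
   the value f z at z. *)
Definition local_min_of (R : realType) (d : nat) (H : 'rV[R]_d -> R^o)
    (I : finType) (f_ : I -> spacetime R d -> R^o) (f : spacetime R d -> R^o)
    (z : spacetime R d) : Prop :=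
  [/\ forall i, affine_fun (f_ i) /\ classical_solution H (f_ i),
      forall i, f_ i z = f z &
      \forall w \near z, is_min (fun i => f_ i w : R) (f w)].

(* The set I(v), for p_i = grad f_i at z. *)
Definition active_set (R : realType) (d : nat) (H : 'rV[R]_d -> R^o)
    (I : finType) (f_ : I -> spacetime R d -> R^o) (z : spacetime R d)
    (v : 'rV[R]_d) : {set I} :=
  let p i := dx (f_ i) z in
  [set j | [forall i,
     (- H (p j) + dotv (p j) v <= - H (p i) + dotv (p i) v :> R)]]%SET.

Definition self_consistent (R : realType) (d : nat) (H : 'rV[R]_d -> R^o)
    (I : finType) (f_ : I -> spacetime R d -> R^o) (z : spacetime R d)
    (v : 'rV[R]_d) : Prop :=
  let A := active_set H f_ z v in
  exists pi_ : I -> R,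
    [/\ forall j, j \in A -> 0 <= pi_ j,
        \sum_(j in A) pi_ j = 1 &
        v = \sum_(j in A) pi_ j *: gradient H (dx (f_ j) z)].

(* Main.v *)
Require Import Defs.
From HB Require Import structures.
From mathcomp Require Import all_boot all_order all_algebra.
From mathcomp Require Import all_classical all_reals all_analysis.
From mathcomp Require Import ring lra.
Import Order.TTheory GRing.Theory Num.Theory.
Import numFieldNormedType.Exports.

(** Let [phi] be the minimum of finitely many plane waves
    [z |-> p_i . x - H(p_i) t], and put [v_i = grad H(p_i)].  For weights [pi_j]
    with mean velocity [v = \sum_j pi_j v_j], the quantity [- H(p_i) + p_i . v]
    equals, up to a term that does not depend on [i], the number
    [- \sum_j D_ij pi_j], where
    [D_ij = H(p_i) - H(p_j) - v_j . (p_i - p_j)] is the Bregman divergence of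
    [H].  A self-consistent velocity is therefore a symmetric Nash equilibrium
    [pi] of the game with payoff matrix [D], whose diagonal is zero and whose
    other entries are positive.  With four strategies grouped in two pairs, such
    a game has three equilibria as soon as the divergence inside a pair is more
    than twice the divergence across pairs: the uniform distribution on either
    pair, and the uniform distribution on all four.

    The momenta are the vertices [(+-2, 0, 1)] and [(0, +-2, -1)] of a
    tetrahedron; the pairs are the two opposite edges perpendicular to the third
    axis.  For a quadratic [H] the divergence is, after a linear change of
    coordinates, a squared Euclidean distance, and the four squared distances
    across two pairs of points add up to at least the two inside the pairs, so
    that the latter cannot both be that large.  The term
    [\sum_j (p_j . p - 4) ^ 4] of [quartic] is sensitive to the orientation of
    the tetrahedron and tilts the gradients along the third axis, so much that
    the mean velocity of an edge points away from that edge
    ([gradient_vertex], where 506 - 872 < 0); the two vertices of this edge are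
    then the active ones ([self_consistent_edge]).  By symmetry the four
    velocities have mean 0, at which every vertex is active
    ([self_consistent_center]).

    That [phi] is a viscosity solution only uses that [H] has a supporting
    affine function at each point ([min_wave_viscosity]).  A test function that
    touches [phi] from below touches an active wave from below, hence has the
    same differential.  One that touches from above at [z], with spatial
    gradient [q], is compared with [phi] along the characteristic
    [z - s (1, v)], where [v] is the slope of a supporting function at [q].

    The supporting function also yields strict convexity and the gradient of
    [quartic]: for [quartic] it comes from the identity in
    [quartic_supporting]. *)

Set Implicit Arguments.
Unset Strict Implicit.
Unset Printing Implicit Defensive.
Local Open Scope classical_set_scope.
Local Open Scope ring_scope.

(** * Differential calculus *)

Section Calculus.
Context {R : realType} {V : normedModType R}.
Implicit Types (f g : V -> R^o) (z v : V).

Lemma linear_derive f z :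
  linear f -> continuous f -> differentiable f z /\ forall v, 'D_v f z = f v.
Proof.
move=> lf cf.
pose F : {linear V -> R^o} := HB.pack f (GRing.isLinear.Build R V R^o _ f lf).
have df : differentiable (F : V -> R^o) z by exact: linear_differentiable.
split=> // v; rewrite (deriveE v df).
by rewrite (@diff_lin _ _ _ F).
Qed.

(** Polynomial functions, generated by the continuous linear forms instead of
    coordinates so that they make sense both on [R^d] and on space-time. *)
Inductive polyfun : (V -> R^o) -> Prop :=
| polyfun_cst (c : R) : polyfun (fun=> c)
| polyfun_linear f : linear f -> continuous f -> polyfun f
| polyfun_add f g : polyfun f -> polyfun g -> polyfun (fun z => f z + g z)
| polyfun_mul f g : polyfun f -> polyfun g -> polyfun (fun z => f z * g z).

Lemma polyfun_sum (J : Type) (s : seq J) (f : J -> V -> R^o) :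
  (forall j, polyfun (f j)) -> polyfun (fun z => \sum_(j <- s) f j z).
Proof.
move=> pf; elim: s => [|j s IHs].
  by under eq_fun do rewrite big_nil; exact: polyfun_cst.
by under eq_fun do rewrite big_cons; exact: polyfun_add.
Qed.

(** The class is closed under [f |-> 'D_v f], by the Leibniz rule; this is all
    that smoothness needs. *)
Lemma polyfun_derive f : polyfun f ->
  (forall z, differentiable f z) /\ (forall v, polyfun ('D_v f)).
Proof.
elim=> {f} [c|f lf cf|f g pf [df Df] pg [dg Dg]|f g pf [df Df] pg [dg Dg]].
- split=> [z|v]; first exact: differentiable_cst.
  have -> : 'D_v (fun=> c : R^o) = (fun=> 0) :> (V -> R^o).
    by apply/funext => z; rewrite derive_cst.
  exact: polyfun_cst.
- split=> [z|v]; first by case: (linear_derive z lf cf).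
  have -> : 'D_v f = (fun=> f v).
    by apply/funext => z; case: (linear_derive z lf cf).
  exact: polyfun_cst.
- split=> [z|v]; first exact: differentiableD.
  have -> : 'D_v (fun z => f z + g z) = (fun z => 'D_v f z + 'D_v g z).
    by apply/funext => z; rewrite (deriveD (f := f)) //; exact: diff_derivable.
  exact: polyfun_add.
- split=> [z|v]; first exact: differentiableM.
  have -> : 'D_v (fun z => f z * g z : R^o) =
            (fun z => f z * 'D_v g z + g z * 'D_v f z).
    by apply/funext => z; rewrite (deriveM (f := f)) //; exact: diff_derivable.
  by apply: polyfun_add; apply: polyfun_mul.
Qed.

Lemma polyfun_smooth f : polyfun f -> smooth f.
Proof.
move=> pf k; elim: k f pf => [|k IHk] f /polyfun_derive[df Df] /=.
  by move=> z; exact: differentiable_continuous.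
by split=> // v; exact: IHk.
Qed.

(** The derivative is also the limit of the difference quotients for [s > 0]. *)
Lemma le_derive f z v (c : R) : differentiable f z ->
  (\forall s \near 0^'+, s * c <= f (s *: v + z) - f z) -> c <= 'D_v f z.
Proof.
move=> df fc.
have /cvg_dnbhs_at_right cvf := @diff_derivable _ _ _ f z v df.
rewrite /derive -(cvg_lim _ cvf) //.
apply: limr_ge; first by apply/cvg_ex; exists ('D_v f z); exact: cvf.
near=> s; have s0 : 0 < s by [].
have h : s * c <= f (s *: v + z) - f z by near: s.
rewrite /= /GRing.scale /= -(ler_pM2l s0) mulrA divff ?gt_eqF // mul1r.
exact: h.
Unshelve. all: by end_near.
Qed.

Lemma near_line z v (P : set V) : (\forall w \near z, P w) ->
  \forall s \near (0:R)^'+, P (s *: v + z).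
Proof.
move=> Pz.
have : (fun s : R => s *: v + z) @ 0^'+ --> z.
  rewrite -[X in _ --> X]add0r -(scale0r v).
  apply: cvgD; last exact: cvg_cst.
  apply: cvgZ; last exact: cvg_cst.
  by apply: cvg_at_right_filter; exact: cvg_id.
exact.
Qed.

Lemma derive_oppv f z v : differentiable f z -> 'D_(- v) f z = - 'D_v f z.
Proof. by move=> df; rewrite !deriveE// linearN. Qed.

(** [g - f] has a local minimum at [z], so its differential is nonnegative in
    the directions [v] and [- v]. *)
Lemma derive_touching f g z v : differentiable f z -> differentiable g z ->
  (\forall w \near z, f w - f z <= g w - g z) -> 'D_v f z = 'D_v g z.
Proof.
move=> df dg fg.
have dgf : differentiable (fun w => g w - f w : R^o) z by exact: differentiableB.
have ge0 u : 0 <= 'D_u (fun w => g w - f w : R^o) z.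
  apply: le_derive => //.
  near=> s; rewrite mulr0.
  have : f (s *: u + z) - f z <= g (s *: u + z) - g z.
    by near: s; exact: (near_line u fg).
  lra.
have DE : 'D_v (fun w => g w - f w : R^o) z = 'D_v g z - 'D_v f z.
  by rewrite (deriveB (f := g)) //; exact: diff_derivable.
have := ge0 v; have := ge0 (- v); rewrite derive_oppv // DE; lra.
Unshelve. all: by end_near.
Qed.

End Calculus.

(** * Scalar product, space-time and plane waves *)

Section Dot.
Context {R : realType} {d : nat}.
Implicit Types (u v w : 'rV[R]_d) (c : R).

Lemma dotvC u v : dotv u v = dotv v u.
Proof. by apply: eq_bigr => i _; rewrite mulrC. Qed.

Lemma dotvDr u v w : dotv u (v + w) = dotv u v + dotv u w.
Proof. by rewrite -big_split; apply: eq_bigr => i _; rewrite mxE mulrDr. Qed.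

Lemma dotvZr c u v : dotv u (c *: v) = c * dotv u v.
Proof. by rewrite big_distrr; apply: eq_bigr => i _; rewrite mxE mulrCA. Qed.

Lemma dotvNr u v : dotv u (- v) = - dotv u v.
Proof. by rewrite -scaleN1r dotvZr mulN1r. Qed.

Lemma dotvBr u v w : dotv u (v - w) = dotv u v - dotv u w.
Proof. by rewrite dotvDr dotvNr. Qed.

Lemma dotv0 u : dotv u 0 = 0.
Proof. by rewrite -(scale0r 0) dotvZr mul0r. Qed.

Lemma dotvDl u v w : dotv (u + v) w = dotv u w + dotv v w.
Proof. by rewrite dotvC dotvDr !(dotvC w). Qed.

Lemma dotvZl c u v : dotv (c *: u) v = c * dotv u v.
Proof. by rewrite dotvC dotvZr dotvC. Qed.

Lemma dotvBl u v w : dotv (u - v) w = dotv u w - dotv v w.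
Proof. by rewrite dotvC dotvBr !(dotvC w). Qed.

Lemma dotv_suml (I : finType) (F : I -> 'rV[R]_d) v :
  dotv (\sum_i F i) v = \sum_i dotv (F i) v.
Proof.
apply: (big_ind2 (fun x y => dotv x v = y)) => //; first by rewrite dotvC dotv0.
by move=> x1 x2 y1 y2 <- <-; rewrite dotvDl.
Qed.

Lemma dotv_delta i v : dotv v (delta_mx ord0 i) = v ord0 i.
Proof.
rewrite /dotv (bigD1 i) //= mxE !eqxx mulr1 big1 ?addr0 // => j ji.
by rewrite mxE eqxx (negbTE ji) mulr0.
Qed.

Lemma dotv_gt0 u : u != 0 -> 0 < dotv u u.
Proof.
move=> u0; have [i ui] : exists i, u ord0 i != 0.
  apply/existsP; apply: contraNT u0 => /existsPn u0; apply/eqP/rowP => i.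
  by rewrite mxE; apply/eqP; have := u0 i; rewrite negbK.
rewrite /dotv (bigD1 i) //= -expr2 ltr_pwDl ?exprn_even_gt0 //.
by apply: sumr_ge0 => j _; rewrite -expr2 sqr_ge0.
Qed.

Lemma dotv_linear u : linear (dotv u : 'rV[R]_d -> R^o).
Proof. by move=> c v w; rewrite dotvDr dotvZr. Qed.

Lemma dotv_continuous u : continuous (dotv u : 'rV[R]_d -> R^o).
Proof.
apply: (@continuous_big R^o); first exact: add_continuous.
move=> i _ x; apply: differentiable_continuous.
exact: (differentiableZ (u ord0 i) (differentiable_coord x ord0 i)).
Qed.

End Dot.

(** Partial derivatives are directional derivatives of the full function: the
    two difference quotients agree. *)
Lemma derive_eq_line {R : realType} {U V : normedModType R}
    (f : U -> R^o) (g : V -> R^o) a u b v :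
  (forall h : R, f (h *: u + a) = g (h *: v + b)) -> 'D_u f a = 'D_v g b.
Proof.
move=> fg; rewrite /derive.
have fgE : (fun h : R => h^-1 *: ((f \o shift a) (h *: u) - f a)) =
       (fun h : R => h^-1 *: ((g \o shift b) (h *: v) - g b)).
  apply/funext => h /=; rewrite /shift /= fg; congr (_ *: (_ - _)).
  by have := fg 0; rewrite !scale0r !add0r.
by rewrite fgE.
Qed.

Section SpaceTime.
Context {R : realType} {d : nat}.
Implicit Types (z w : spacetime R d) (p v : 'rV[R]_d).

Lemma dtE (f : spacetime R d -> R^o) z :
  dt f z = 'D_((1, 0) : spacetime R d) f z.
Proof.
rewrite /dt derive1E; apply: derive_eq_line => h.
by case: z => t x; congr (f (_, _)); rewrite /= scaler0 add0r.
Qed.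

Lemma dxE (f : spacetime R d -> R^o) z i :
  dx f z ord0 i = 'D_((0, delta_mx ord0 i) : spacetime R d) f z.
Proof.
rewrite /dx /gradient mxE; apply: derive_eq_line => h.
by case: z => t x; congr (f (_, _)); rewrite /= scaler0 add0r.
Qed.

Lemma derive_spacetime (f : spacetime R d -> R^o) z (s : R) v :
  differentiable f z ->
  'D_((s, v) : spacetime R d) f z = s * dt f z + dotv (dx f z) v.
Proof.
move=> df; rewrite dtE !deriveE //.
have -> : ((s, v) : spacetime R d) =
  s *: ((1, 0) : spacetime R d)
  + \sum_i v ord0 i *: ((0, delta_mx ord0 i) : spacetime R d).
  rewrite [LHS](_ : _ = (s, 0) + (0, v)); last first.
    by congr pair; rewrite /= ?addr0 ?add0r.
  congr (_ + _); first by congr pair; rewrite /= ?scaler0 //; exact/esym/mulr1.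
  rewrite [in LHS](row_sum_delta v).
  apply: (big_ind2 (fun x y => ((0, x) : spacetime R d) = y)) => //.
    by move=> x1 x2 y1 y2 <- <-; congr pair; rewrite /= addr0.
  by move=> i _; congr pair; rewrite /= scaler0.
rewrite linearD linearZ linear_sum; congr (_ + _); apply: eq_bigr => i _.
by rewrite linearZ dxE deriveE // mulrC.
Qed.

(** The linear solution with momentum [p] that vanishes at the origin. *)
Definition wave (H : 'rV[R]_d -> R^o) p z : R^o := dotv p z.2 - H p * z.1.

Lemma wave_linear H p : linear (wave H p).
Proof.
by move=> c x y; rewrite /wave /= dotvDr dotvZr /GRing.scale /=; ring.
Qed.

Lemma wave_continuous H p : continuous (wave H p).
Proof.
move=> z; apply: cvgB.
  apply: (@continuous_comp _ _ _ (@snd _ _) (dotv p)); first exact: cvg_snd.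
  exact: dotv_continuous.
by apply: (cvgZ (cvg_cst (H p))); exact: cvg_fst.
Qed.

Lemma wave_derive H p z w :
  differentiable (wave H p) z /\ 'D_w (wave H p) z = wave H p w.
Proof.
have [dw Dw] := linear_derive z (wave_linear H p) (@wave_continuous H p).
by split.
Qed.

Lemma dt_wave H p z : dt (wave H p) z = - H p.
Proof.
by rewrite dtE (wave_derive H p z _).2 /wave /= dotv0 mulr1 sub0r.
Qed.

Lemma dx_wave H p z : dx (wave H p) z = p.
Proof.
apply/rowP => i; rewrite dxE (wave_derive H p z _).2 /wave /= dotv_delta.
by rewrite mulr0 subr0.
Qed.

Lemma wave_affine H p : affine_fun (wave H p).
Proof. by exists 0, (- H p), p => z; rewrite /wave; ring. Qed.

Lemma wave_solution H p : classical_solution H (wave H p).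
Proof.
split=> [|z]; last by rewrite dt_wave dx_wave addNr.
apply/polyfun_smooth/polyfun_linear; first exact: wave_linear.
exact: wave_continuous.
Qed.

End SpaceTime.

(** * Minima of plane waves *)

Section MinWave.
Context {R : realType} {d : nat}.
Variables (H : 'rV[R]_d -> R^o) (I : finType) (i0 : I) (a : I -> 'rV[R]_d).

(** A wave of the family serves as initial value of the minimum, because [R] has
    no greatest element. *)
Definition min_wave (z : spacetime R d) : R^o :=
  \big[Num.min/wave H (a i0) z]_i wave H (a i) z.

Lemma min_wave_is_min z : is_min (fun i => wave H (a i) z : R) (min_wave z).
Proof.
split=> [i|]; first exact: bigmin_le.
have [i _ ->] : {i | i \in I & min_wave z = wave H (a i) z}.
  rewrite /min_wave; elim/big_ind: _ => [|x y [i _ ->] [j _ ->]|i _].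
  - by exists i0.
  - by rewrite /Num.min; case: ifP; [exists i|exists j].
  - by exists i.
by exists i.
Qed.

Lemma min_wave_continuous : continuous min_wave.
Proof.
rewrite /min_wave /index_enum; elim: (Finite.enum I) => [|i r IHr] z.
  by under eq_fun do rewrite big_nil; exact: wave_continuous.
under eq_fun do rewrite big_cons.
by apply: continuous_min; [exact: wave_continuous|exact: IHr].
Qed.

(** The pieces are the sets where a given wave is the smallest. *)
Lemma min_wave_piecewise_linear : piecewise_linear min_wave.
Proof.
pose b (i : 'I_#|I|) := a (enum_val i).
exists #|I|, (fun i => [set z | forall j, 0 <= wave H (b j) z - wave H (b i) z]).
split=> [i|z|i].
- exists #|I|, (fun j z => wave H (b j) z - wave H (b i) z); split=> // j.
  by exists 0, (H (b i) - H (b j)), (b j - b i) => z; rewrite dotvBl /wave; ring.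
- have [le_min [i min_i]] := min_wave_is_min z.
  exists (enum_rank i) => j; rewrite subr_ge0 /b enum_rankK -min_i.
  exact: le_min.
- exists (wave H (b i)); first exact: wave_affine.
  move=> z zi; have [le_min [j min_j]] := min_wave_is_min z.
  apply/eqP; rewrite eq_le le_min min_j -subr_ge0.
  by have := zi (enum_rank j); rewrite /b enum_rankK.
Qed.

Lemma min_wave_local_min z : (forall i j, wave H (a i) z = wave H (a j) z) ->
  local_min_of H (fun i => wave H (a i)) min_wave z.
Proof.
move=> eq_z; split=> [i|i|].
- by split; [exact: wave_affine|exact: wave_solution].
- by have [_ [j ->]] := min_wave_is_min z; exact: eq_z.
- by near=> w; exact: min_wave_is_min.
Unshelve. all: by end_near.
Qed.

(** [psi] touches the active wave [i] from below at [z] as well, and that wave is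
    differentiable. *)
Lemma touching_below_min_wave (psi : spacetime R d -> R^o) z i :
  differentiable psi z -> min_wave z = wave H (a i) z ->
  (\forall w \near z, psi w - psi z <= min_wave w - min_wave z) ->
  dt psi z = - H (a i) /\ dx psi z = a i.
Proof.
move=> dpsi min_i below.
have D v : 'D_v psi z = 'D_v (wave H (a i)) z.
  apply: derive_touching => //; first exact: (wave_derive H (a i) z v).1.
  near=> w.
  have : psi w - psi z <= min_wave w - min_wave z by near: w.
  move=> /le_trans; apply; rewrite min_i lerD2r.
  exact: (min_wave_is_min w).1.
split; first by rewrite dtE D -dtE dt_wave.
by apply/rowP => k; rewrite dxE D -dxE dx_wave.
Unshelve. all: by end_near.
Qed.

(** If the minimum were differentiable at a point where all waves agree, it could
    itself be taken as the test function, and would have every [a k] as its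
    gradient. *)
Lemma min_wave_singular z : (forall i j, wave H (a i) z = wave H (a j) z) ->
  (exists i j, a i != a j) -> singular min_wave z.
Proof.
move=> eq_z [i [j /eqP aij]] dmin; apply: aij.
have dxi k : dx min_wave z = a k.
  have [_ [l min_l]] := min_wave_is_min z.
  apply: (touching_below_min_wave dmin _ _).2; first by rewrite min_l; exact: eq_z.
  by near=> w; exact: lexx.
by rewrite -!dxi.
Unshelve. all: by end_near.
Qed.

Hypothesis supporting : forall q, exists v,
  forall p, H q + dotv v (p - q) <= H p.

(** For the subsolution property let [q := dx psi z].  One step back along the
    characteristic of velocity [v], a wave [i] realizes the minimum; its change
    [s (H (a i) - a i . v)] is at least [s (H q - q . v)] because [v] supports [H]
    at [q].  Since [psi] lies above, its derivative [- dt psi z - q . v] in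
    the direction [(-1, - v)] is at least [H q - q . v]. *)
Lemma min_wave_viscosity : viscosity_solution H min_wave.
Proof.
split=> [|psi z [dpsi _] above|psi z [dpsi _] below].
- exact: min_wave_continuous.
- have [v vP] := supporting (dx psi z).
  have : H (dx psi z) - dotv (dx psi z) v
         <= 'D_((-1, - v) : spacetime R d) psi z.
    apply: le_derive; first exact: dpsi.
    have above_v := near_line ((-1, - v) : spacetime R d) above.
    near=> s.
    have s0 : 0 < s by [].
    have le_above : min_wave (s *: ((-1, - v) : spacetime R d) + z)
                    - psi (s *: ((-1, - v) : spacetime R d) + z)
                    <= min_wave z - psi z by near: s.
    have [_ [i min_i]] :=
      min_wave_is_min (s *: ((-1, - v) : spacetime R d) + z).
    have min_z := (min_wave_is_min z).1 i.
    move: le_above; rewrite min_i wave_linear => le_above.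
    have wave_v : wave H (a i) (-1, - v) = H (a i) - dotv (a i) v.
      by rewrite /wave /= dotvNr; ring.
    have : s * (H (dx psi z) - dotv (dx psi z) v)
           <= s * wave H (a i) (-1, - v).
      rewrite ler_pM2l // wave_v.
      have := vP (a i); rewrite dotvBr !(dotvC v); lra.
    rewrite /GRing.scale /= in le_above *; lra.
  rewrite derive_spacetime // dotvNr; lra.
- have [_ [i min_i]] := min_wave_is_min z.
  have [||-> ->] := @touching_below_min_wave psi z i _ min_i; first exact: dpsi.
    near=> w.
    have : min_wave z - psi z <= min_wave w - psi w by near: w.
    lra.
  by rewrite addNr.
Unshelve. all: by end_near.
Qed.

End MinWave.

(** * Supporting functions and the Hamiltonian *)

Section Support.
Context {R : realType} {d : nat}.
Variables (H : 'rV[R]_d -> R^o) (G : 'rV[R]_d -> 'rV[R]_d).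
Implicit Types p q : 'rV[R]_d.

(** The affine function [p |-> H q + dotv (G q) (p - q)] touches [H] from below. *)
Lemma gradient_supporting q : differentiable H q ->
  (forall p, H q + dotv (G q) (p - q) <= H p) -> gradient H q = G q.
Proof.
move=> dH supp; apply/rowP => i; rewrite mxE.
have [dl Dl] := linear_derive q (dotv_linear (G q)) (dotv_continuous (u := G q)).
rewrite -(derive_touching (f := dotv (G q) : 'rV[R]_d -> R^o)) //.
  by rewrite Dl dotv_delta.
near=> p; rewrite -dotvBr; have := supp p; lra.
Unshelve. all: by end_near.
Qed.

(** Both ends of the segment are compared with the supporting function at the
    intermediate point. *)
Lemma strictly_convex_supporting :
  (forall p q, p != q -> H q + dotv (G q) (p - q) < H p) -> strictly_convex H.
Proof.
move=> supp p q s /eqP pq s0 s1; set r := s *: p + (1 - s) *: q.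
have pr : p - r = (1 - s) *: (p - q).
  by apply/rowP => i; rewrite !mxE; ring.
have qr : q - r = - s *: (p - q).
  by apply/rowP => i; rewrite !mxE; ring.
have s1' : 1 - s != 0 by rewrite gt_eqF // subr_gt0.
have pNr : p != r.
  by rewrite -subr_eq0 pr scaler_eq0 negb_or s1' subr_eq0.
have qNr : q != r.
  by rewrite -subr_eq0 qr scaler_eq0 negb_or oppr_eq0 gt_eqF //= subr_eq0.
have := supp _ _ pNr; have := supp _ _ qNr; rewrite pr qr !dotvZr.
set g := dotv _ _; nra.
Qed.

End Support.

Section QuarticHamiltonian.
Context {R : realType} {d : nat} {I : finType}.
Variable a : I -> 'rV[R]_d.
Implicit Types p q : 'rV[R]_d.

(** The shift 4 makes the derivative [f] of [(t - 4) ^ 4] satisfy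
    [2 + f(5) + f(-3) - 2 f(-1) < 0], where 5, -3, -1 are the scalar products of
    the momenta ([gram]): this is the tilt along the axis. *)
Definition quartic p : R^o := dotv p p + \sum_i (dotv (a i) p - 4) ^+ 4.

Definition quartic_grad q : 'rV[R]_d :=
  2 *: q + \sum_i (4 * (dotv (a i) q - 4) ^+ 3) *: a i.

(** The strict inequality comes from [dotv p p], convexity of the rest from the
    tangent lines of [t ^ 4]. *)
Lemma quartic_supporting p q : p != q ->
  quartic q + dotv (quartic_grad q) (p - q) < quartic p.
Proof.
rewrite -subr_eq0 => /dotv_gt0 pq_gt0.
rewrite /quartic /quartic_grad dotvDl dotvZl dotv_suml.
have dotp : dotv p p = dotv q q + 2 * dotv q (p - q) + dotv (p - q) (p - q).
  by rewrite !dotvBr !dotvBl (dotvC p q); ring.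
have : \sum_i (dotv (a i) q - 4) ^+ 4
    + \sum_i dotv ((4 * (dotv (a i) q - 4) ^+ 3) *: a i) (p - q)
    <= \sum_i (dotv (a i) p - 4) ^+ 4.
  rewrite -big_split; apply: ler_sum => i _ /=; rewrite dotvZl dotvBr.
  set x := dotv _ p; set y := dotv _ q.
  (* The remainder of the tangent line of [t ^ 4] is a product of a square and a
     sum of squares. *)
  have -> : (x - 4) ^+ 4 = (y - 4) ^+ 4 + 4 * (y - 4) ^+ 3 * (x - y)
    + (x - y) ^+ 2 * ((x - 4 + (y - 4)) ^+ 2 + 2 * (y - 4) ^+ 2) by ring.
  rewrite lerDl mulr_ge0 ?sqr_ge0 // addr_ge0 ?sqr_ge0 // mulr_ge0 //.
  exact: sqr_ge0.
lra.
Qed.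

Lemma quartic_supporting_le p q :
  quartic q + dotv (quartic_grad q) (p - q) <= quartic p.
Proof.
have [->|pq] := eqVneq p q; first by rewrite subrr dotv0 addr0.
exact/ltW/quartic_supporting.
Qed.

Lemma polyfun_dotv u : polyfun (dotv u : 'rV[R]_d -> R^o).
Proof. exact: polyfun_linear (dotv_linear u) (@dotv_continuous _ _ u). Qed.

Lemma polyfun_quartic : polyfun quartic.
Proof.
apply: polyfun_add; apply: polyfun_sum => i.
  have -> : (fun p : 'rV[R]_d => p ord0 i * p ord0 i : R^o) =
            (fun p => dotv (delta_mx ord0 i) p * dotv (delta_mx ord0 i) p).
    by apply/funext => p; rewrite dotvC dotv_delta.
  by apply: polyfun_mul; exact: polyfun_dotv.
have pl : polyfun (fun p => dotv (a i) p - 4 : R^o).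
  by apply: polyfun_add; [exact: polyfun_dotv|exact: polyfun_cst].
by do 3!apply: polyfun_mul => //.
Qed.

Lemma gradient_quartic p : gradient quartic p = quartic_grad p.
Proof.
apply: gradient_supporting; first exact: (polyfun_derive polyfun_quartic).1.
by move=> q; exact: quartic_supporting_le.
Qed.

End QuarticHamiltonian.

(** It is enough that the weights, given on the whole index set, vanish outside
    the active set. *)
Lemma self_consistent_waves {R : realType} {d : nat} (H : 'rV[R]_d -> R^o)
    (I : finType) (a : I -> 'rV[R]_d) (pi_ : I -> R) z v :
  (forall i, 0 <= pi_ i) -> \sum_i pi_ i = 1 ->
  (forall j, pi_ j != 0 -> forall i,
    - H (a j) + dotv (a j) v <= - H (a i) + dotv (a i) v) ->
  v = \sum_i pi_ i *: gradient H (a i) ->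
  self_consistent H (fun i => wave H (a i)) z v.
Proof.
move=> pi_ge0 sum_pi act vE; exists pi_.
have pi0 j : j \notin active_set H (fun i => wave H (a i)) z v -> pi_ j = 0.
  apply: contraNeq => /act le_j; rewrite inE; apply/forallP => i.
  by rewrite !dx_wave.
split=> [j _||]; first exact: pi_ge0.
  rewrite big_mkcond -[RHS]sum_pi; apply: eq_bigr => j _.
  by case: ifPn => // /pi0.
rewrite big_mkcond [LHS]vE; apply: eq_bigr => j _ /=; rewrite dx_wave.
by case: ifPn => // /pi0 ->; rewrite scale0r.
Qed.

(** * The tetrahedron and its three self-consistent velocities *)

Section Configuration.
Context {R : realType} {d : nat}.
Variable k : 'I_3 -> 'I_d.
Hypothesis k_inj : injective k.

Local Notation e i := (delta_mx ord0 (k i) : 'rV[R]_d).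
Local Notation axis := (delta_mx ord0 (k ord_max) : 'rV[R]_d).

(** [i.1] chooses one of two opposite edges of the tetrahedron, [i.2] an end of
    it.  The momenta lie in the three-dimensional subspace spanned by the
    coordinates [k]. *)
Definition vertex (i : bool * bool) : 'rV[R]_d :=
  (2 * (-1) ^+ i.2) *: delta_mx ord0 (k (inord i.1)) + (-1) ^+ i.1 *: axis.

Lemma dotv_deltas i j : dotv (e i) (e j) = (i == j)%:R.
Proof. by rewrite dotv_delta mxE eqxx (inj_eq k_inj) eq_sym. Qed.

Lemma vertex_axis i : dotv (vertex i) axis = (-1) ^+ i.1.
Proof.
rewrite /vertex dotvDl !dotvZl !dotv_deltas eqxx -val_eqE /= inordK; last by case: i.1.
by case: i => [[] []] /=; ring.
Qed.

Lemma gram i j : dotv (vertex i) (vertex j) =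
  if i.1 == j.1 then if i.2 == j.2 then 5 else -3 else -1.
Proof.
rewrite {2}/vertex dotvDr !dotvZr vertex_axis /vertex dotvDl !dotvZl.
rewrite !dotv_deltas -!val_eqE /= !inordK; try by [case: i.1|case: j.1].
by case: i j => [[] []] [[] []] /=; ring.
Qed.

Lemma big_pair_bool (V : nmodType) (F : bool * bool -> V) :
  \sum_i F i =
  F (true, true) + F (true, false) + (F (false, true) + F (false, false)).
Proof.
rewrite (eq_bigr (fun i => F (i.1, i.2))) => [|[]//].
by rewrite -(pair_bigA _ (fun i j => F (i, j))) !big_bool.
Qed.

Lemma quartic_vertex i : quartic vertex (vertex i) = 3657.
Proof. by rewrite /quartic big_pair_bool !gram; case: i => [[] []] /=; ring. Qed.

(** The four vertices sum to zero, so that the contribution of the other edge is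
    absorbed into that of [i] and of the opposite end of its edge. *)
Lemma gradient_vertex i : gradient (quartic vertex) (vertex i) =
  506 *: vertex i - 872 *: vertex (i.1, ~~ i.2).
Proof.
rewrite gradient_quartic /quartic_grad big_pair_bool !gram.
case: i => [[] []]; rewrite /vertex /=; apply/rowP => j; rewrite !mxE; ring.
Qed.

(** The gradients at the two ends of an edge have mean
    [(506 - 872) * (-1) ^+ b] along the axis.  Since [quartic] takes the
    same value at all vertices, a vertex is active when its height on the axis
    is of the sign opposite to this velocity, which is the case on edge [b]. *)
Lemma self_consistent_edge (b : bool) z :
  self_consistent (quartic vertex) (fun i => wave (quartic vertex) (vertex i)) z
    ((-366 * (-1) ^+ b) *: axis).
Proof.
apply: (@self_consistent_waves _ _ _ _ _ (fun i => if i.1 == b then 2^-1 else 0)).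
- by move=> i; case: ifP => // _; rewrite invr_ge0.
- by rewrite big_pair_bool /=; case: b; rewrite /=; field.
- move=> j; case: (eqVneq j.1 b) => [jb _ i|]; last by rewrite eqxx.
  rewrite !quartic_vertex lerD2l !dotvZr !vertex_axis jb.
  by case: b (i.1) {jb} => [] [] /=; lra.
- rewrite big_pair_bool !gradient_vertex /vertex.
  by apply/rowP => j; case: b; rewrite /= !mxE; field.
Qed.

Lemma self_consistent_center z :
  self_consistent (quartic vertex) (fun i => wave (quartic vertex) (vertex i)) z
    0.
Proof.
apply: (@self_consistent_waves _ _ _ _ _ (fun=> 4^-1)).
- by move=> i; rewrite invr_ge0.
- by rewrite big_pair_bool; field.
- by move=> j _ i; rewrite !quartic_vertex !dotv0.
- rewrite big_pair_bool !gradient_vertex /vertex.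
  by apply/rowP => j; rewrite /= !mxE; field.
Qed.

End Configuration.

Theorem mainTheorem3 (R : realType) (d : nat) (hd : (3 <= d)%N) :
  exists (H : 'rV[R]_d -> R^o) (phi : spacetime R d -> R^o)
         (z : spacetime R d) (I : finType) (phi_ : I -> spacetime R d -> R^o),
    [/\ smooth H /\ strictly_convex H,
        viscosity_solution H phi /\ piecewise_linear phi,
        singular phi z,
        local_min_of H phi_ phi z &
        exists v1 v2 v3 : 'rV[R]_d,
          [/\ v1 <> v2, v1 <> v3 & v2 <> v3] /\
          [/\ self_consistent H phi_ z v1,
              self_consistent H phi_ z v2 &
              self_consistent H phi_ z v3]].
Proof.
pose k := widen_ord hd.
have k_inj : injective k by move=> i j /(congr1 val) /= /val_inj.
pose a := @vertex R d k; pose H := quartic a.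
have wave0 i j : wave H (a i) 0 = wave H (a j) 0.
  by rewrite /wave /= !dotv0 !mulr0.
exists H, (min_wave H (true, true) a), 0, (bool * bool)%type.
exists (fun i => wave H (a i)); split.
- split; first exact/polyfun_smooth/polyfun_quartic.
  by apply: strictly_convex_supporting => p q; exact: quartic_supporting.
- split; last exact: min_wave_piecewise_linear.
  apply: min_wave_viscosity => q; exists (quartic_grad a q) => p.
  exact: quartic_supporting_le.
- apply: min_wave_singular => //; exists (true, true), (false, true).
  apply/eqP => /(congr1 (fun p => dotv p (delta_mx ord0 (k ord_max)))).
  by rewrite !vertex_axis //=; lra.
- exact: min_wave_local_min.
- pose x : 'rV[R]_d := delta_mx ord0 (k ord_max).
  have x0 (c : R) : c != 0 -> c *: x <> 0.
    move=> c0 /rowP /(_ (k ord_max)) /eqP; rewrite !mxE !eqxx mulr1.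
    by rewrite (negbTE c0).
  exists ((-366 * (-1) ^+ true) *: x), ((-366 * (-1) ^+ false) *: x), 0.
  split; split.
  + move/eqP; rewrite -subr_eq0 -scalerBl => /eqP; apply: x0; apply/eqP => /=; lra.
  + by apply: x0; apply/eqP => /=; lra.
  + by apply: x0; apply/eqP => /=; lra.
  + exact: self_consistent_edge.
  + exact: self_consistent_edge.
  + exact: self_consistent_center.
Qed.
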